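(* Let $\mathfrak N^{\mathrm{semidet}}$ be the set of all 2-user semi-deterministic discrete memoryless broadcast channels, and for $\mathcal N\in\mathfrak N^{\mathrm{semidet}}$ let $C_\Sigma^{\mathrm{NS}}(\mathcal N)$ and $C_\Sigma(\mathcal N)$ be its sum-capacity with and without NS-assistance. Then $$\sup_{\mathcal N\in\mathfrak N^{\mathrm{semidet}}}\frac{C_\Sigma^{\mathrm{NS}}(\mathcal N)}{C_\Sigma(\mathcal N)}=2.$$
   Context: A 2-user BC $(\mathcal X,\mathcal Y_1,\mathcal Y_2,\mathcal N_{Y_1Y_2\mid X})$ is semi-deterministic if for some $k\in\{1,2\}$ the marginal $\mathcal N_{Y_k\mid X}(y_k\mid x)\in\{0,1\}$ for all $x,y_k$. Coding framework: messages $W_1,W_2$ independent and uniform on finite sets $\mathcal M_1,\mathcal M_2$. Classical scheme: stochastic encoder $X^{[n]}=\phi(W_1,W_2)$, stochastic decoders $\hat W_k=\psi_k(Y_k^{[n]})$. A $\kappa$-partite NS box is a conditional pmf $\mathcal Z(b_1,\dots,b_\kappa\mid a_1,\dots,a_\kappa)$ (finite output alphabets) such that for every subset of parties the marginal of their outputs depends only on their own inputs. NS-assisted scheme: a 3-partite NS box where the transmitter inputs $(W_1,W_2)$ and obtains $U\in\mathcal X^n$, sent as $X^{[n]}=U$; Rx-$k$ inputs $Y_k^{[n]}$ and obtains $\hat W_k$; joint law $\frac{1}{|\mathcal M_1||\mathcal M_2|}\mathcal Z(x^{[n]},\hat w_1,\hat w_2\mid w_1,w_2,y_1^{[n]},y_2^{[n]})\mathcal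 N^{\otimes n}(y_1^{[n]},y_2^{[n]}\mid x^{[n]})$. A rate pair is achievable if there is a sequence of schemes with $\max_k\Pr(\hat W_k\ne W_k)\to0$ and $\lim_n\frac1n\log_2|\mathcal M_k^{(n)}|\ge R_k$; capacity regions are closures of achievable pairs, and sum-capacity is the maximum of $R_1+R_2$ over the region. *)

(* Defs.v *)
From HB Require Import structures.
From mathcomp Require Import all_boot all_order all_algebra.
From mathcomp Require Import all_classical all_reals all_analysis.
Set Implicit Arguments. Unset Strict Implicit. Unset Printing Implicit Defensive.
Import Order.TTheory GRing.Theory Num.Theory.
Import numFieldNormedType.Exports.
Local Open Scope classical_set_scope.
Local Open Scope ring_scope.

Section BC.
Variable R : realType.

Definition log2 (x : R) : R := ln x / ln 2.

Definition cpmf (A B : finType) (K : A -> B -> R) : Prop :=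
  (forall a b, 0 <= K a b) /\ (forall a, \sum_(b : B) K a b = 1).

Variables (X Y1 Y2 : finType).

Definition is_bc (N : X -> Y1 -> Y2 -> R) : Prop :=
  (forall x y1 y2, 0 <= N x y1 y2) /\
  (forall x, \sum_(y1 : Y1) \sum_(y2 : Y2) N x y1 y2 = 1).

Definition marg1 (N : X -> Y1 -> Y2 -> R) x y1 := \sum_(y2 : Y2) N x y1 y2.
Definition marg2 (N : X -> Y1 -> Y2 -> R) x y2 := \sum_(y1 : Y1) N x y1 y2.

Definition semidet (N : X -> Y1 -> Y2 -> R) : Prop :=
  (forall x y1, marg1 N x y1 = 0 \/ marg1 N x y1 = 1) \/
  (forall x y2, marg2 N x y2 = 0 \/ marg2 N x y2 = 1).

Definition chan_n (N : X -> Y1 -> Y2 -> R) (n : nat)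
  (x : n.-tuple X) (y1 : n.-tuple Y1) (y2 : n.-tuple Y2) : R :=
  \prod_(i < n) N (tnth x i) (tnth y1 i) (tnth y2 i).

Definition cerr1 (N : X -> Y1 -> Y2 -> R) (n m1 m2 : nat)
  (enc : 'I_m1 * 'I_m2 -> n.-tuple X -> R)
  (dec1 : n.-tuple Y1 -> 'I_m1 -> R) : R :=
  (m1%:R * m2%:R)^-1 *
  \sum_(w : 'I_m1 * 'I_m2) \sum_(x : n.-tuple X) \sum_(y1 : n.-tuple Y1)
    \sum_(y2 : n.-tuple Y2)
    enc w x * chan_n N x y1 y2 * \sum_(v : 'I_m1 | v != w.1) dec1 y1 v.

Definition cerr2 (N : X -> Y1 -> Y2 -> R) (n m1 m2 : nat)
  (enc : 'I_m1 * 'I_m2 -> n.-tuple X -> R)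
  (dec2 : n.-tuple Y2 -> 'I_m2 -> R) : R :=
  (m1%:R * m2%:R)^-1 *
  \sum_(w : 'I_m1 * 'I_m2) \sum_(x : n.-tuple X) \sum_(y1 : n.-tuple Y1)
    \sum_(y2 : n.-tuple Y2)
    enc w x * chan_n N x y1 y2 * \sum_(v : 'I_m2 | v != w.2) dec2 y2 v.

Definition rates_ok (m1 m2 : nat -> nat) (r : R * R) : Prop :=
  exists L1 L2 : R,
    (fun n : nat => log2 (m1 n)%:R / n%:R) @ \oo --> L1 /\
    (fun n : nat => log2 (m2 n)%:R / n%:R) @ \oo --> L2 /\
    r.1 <= L1 /\ r.2 <= L2.

Definition c_achievable (N : X -> Y1 -> Y2 -> R) (r : R * R) : Prop :=
  exists (m1 m2 : nat -> nat)
    (enc : forall n, 'I_(m1 n) * 'I_(m2 n) -> n.-tuple X -> R)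
    (dec1 : forall n, n.-tuple Y1 -> 'I_(m1 n) -> R)
    (dec2 : forall n, n.-tuple Y2 -> 'I_(m2 n) -> R),
    (forall n, (0 < m1 n)%N /\ (0 < m2 n)%N) /\
    (forall n, cpmf (enc n)) /\ (forall n, cpmf (dec1 n)) /\
    (forall n, cpmf (dec2 n)) /\
    (fun n : nat => Num.max (cerr1 N (enc n) (dec1 n)) (cerr2 N (enc n) (dec2 n)))
      @ \oo --> (0 : R) /\
    rates_ok m1 m2 r.

Definition ns_box (A1 A2 A3 B1 B2 B3 : finType)
  (Z : A1 -> A2 -> A3 -> B1 -> B2 -> B3 -> R) : Prop :=
  (forall a1 a2 a3 b1 b2 b3, 0 <= Z a1 a2 a3 b1 b2 b3) /\
  (forall a1 a2 a3, \sum_(b1 : B1) \sum_(b2 : B2) \sum_(b3 : B3) Z a1 a2 a3 b1 b2 b3 = 1) /\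
  (forall a1 a2 a3 a3' b1 b2,
     \sum_(b3 : B3) Z a1 a2 a3 b1 b2 b3 = \sum_(b3 : B3) Z a1 a2 a3' b1 b2 b3) /\
  (forall a1 a2 a2' a3 b1 b3,
     \sum_(b2 : B2) Z a1 a2 a3 b1 b2 b3 = \sum_(b2 : B2) Z a1 a2' a3 b1 b2 b3) /\
  (forall a1 a1' a2 a3 b2 b3,
     \sum_(b1 : B1) Z a1 a2 a3 b1 b2 b3 = \sum_(b1 : B1) Z a1' a2 a3 b1 b2 b3) /\
  (forall a1 a2 a3 a2' a3' b1,
     \sum_(b2 : B2) \sum_(b3 : B3) Z a1 a2 a3 b1 b2 b3 =
     \sum_(b2 : B2) \sum_(b3 : B3) Z a1 a2' a3' b1 b2 b3) /\
  (forall a1 a2 a3 a1' a3' b2,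
     \sum_(b1 : B1) \sum_(b3 : B3) Z a1 a2 a3 b1 b2 b3 =
     \sum_(b1 : B1) \sum_(b3 : B3) Z a1' a2 a3' b1 b2 b3) /\
  (forall a1 a2 a3 a1' a2' b3,
     \sum_(b1 : B1) \sum_(b2 : B2) Z a1 a2 a3 b1 b2 b3 =
     \sum_(b1 : B1) \sum_(b2 : B2) Z a1' a2' a3 b1 b2 b3).

Definition nserr1 (N : X -> Y1 -> Y2 -> R) (n m1 m2 : nat)
  (Z : 'I_m1 * 'I_m2 -> n.-tuple Y1 -> n.-tuple Y2 -> n.-tuple X -> 'I_m1 -> 'I_m2 -> R) : R :=
  (m1%:R * m2%:R)^-1 *
  \sum_(w : 'I_m1 * 'I_m2) \sum_(x : n.-tuple X) \sum_(y1 : n.-tuple Y1)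
    \sum_(y2 : n.-tuple Y2) \sum_(v1 : 'I_m1 | v1 != w.1) \sum_(v2 : 'I_m2)
    Z w y1 y2 x v1 v2 * chan_n N x y1 y2.

Definition nserr2 (N : X -> Y1 -> Y2 -> R) (n m1 m2 : nat)
  (Z : 'I_m1 * 'I_m2 -> n.-tuple Y1 -> n.-tuple Y2 -> n.-tuple X -> 'I_m1 -> 'I_m2 -> R) : R :=
  (m1%:R * m2%:R)^-1 *
  \sum_(w : 'I_m1 * 'I_m2) \sum_(x : n.-tuple X) \sum_(y1 : n.-tuple Y1)
    \sum_(y2 : n.-tuple Y2) \sum_(v1 : 'I_m1) \sum_(v2 : 'I_m2 | v2 != w.2)
    Z w y1 y2 x v1 v2 * chan_n N x y1 y2.

Definition ns_achievable (N : X -> Y1 -> Y2 -> R) (r : R * R) : Prop :=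
  exists (m1 m2 : nat -> nat)
    (Z : forall n, 'I_(m1 n) * 'I_(m2 n) -> n.-tuple Y1 -> n.-tuple Y2 ->
                   n.-tuple X -> 'I_(m1 n) -> 'I_(m2 n) -> R),
    (forall n, (0 < m1 n)%N /\ (0 < m2 n)%N) /\
    (forall n, ns_box (Z n)) /\
    (fun n : nat => Num.max (nserr1 N (Z n)) (nserr2 N (Z n))) @ \oo --> (0 : R) /\
    rates_ok m1 m2 r.

Definition cap_region N : set (R * R) := closure (c_achievable N).
Definition ns_cap_region N : set (R * R) := closure (ns_achievable N).

Definition sum_cap N : R := sup [set r.1 + r.2 | r in cap_region N].
Definition ns_sum_cap N : R := sup [set r.1 + r.2 | r in ns_cap_region N].

End BC.

(* Main.v *)
(* Upper bound: no-signaling assistance does not help a single user. Given an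
   assisted code with [m] messages for receiver 1, summing its box over the
   messages gives [p(x)] and [r(x, y)] with [r <= p], [sum_x p = m] and
   [sum_x r <= 1]. Drawing [l] codewords from [p / m] and decoding [y] to the
   [i]th codeword with probability [a_i * prod_(j != i) (1 - a_j)], where
   [a = r / p], loses only a factor [1 - (l - 1) / m] in success probability,
   so [l ~ m / n] costs no rate. Hence each of the two assisted rates is
   achieved alone without assistance, and the sum is at most twice the
   unassisted sum-capacity.
   Tightness: over a field with [q] elements let the input be [(s, v)], let
   receiver 1 see [s] and receiver 2 a uniform point [(a, b)] of the line
   [a + s b = v]. With assistance, a pad [v] known to the box gives both
   receivers [log q] without error. Without assistance, pairwise independence
   of the events [a + s b = v] and a second moment bound show that the joint
   success probability is at most [(1 + (2 q)^n / (m1 m2)) / 2], so the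
   sum-capacity is at most [log (2 q)]. The ratio [2 log q / log (2 q)] tends
   to 2. *)
Require Import Defs.
From HB Require Import structures.
From mathcomp Require Import all_boot all_order all_algebra.
From mathcomp Require Import all_classical all_reals all_analysis.
From mathcomp Require Import ring lra.
Set Implicit Arguments. Unset Strict Implicit. Unset Printing Implicit Defensive.
Import Order.TTheory GRing.Theory Num.Theory.
Import numFieldNormedType.Exports.
Local Open Scope classical_set_scope.
Local Open Scope ring_scope.

(** * Random coding from a no-signaling code *)

Section FiniteSums.
Variable R : realType.

Lemma sum_prod_tuple (T : finType) n (F : 'I_n -> T -> R) :
  \sum_(x : n.-tuple T) \prod_(i < n) F i (tnth x i) =
  \prod_(i < n) \sum_(t : T) F i t.
Proof.
rewrite bigA_distr_bigA /=.
rewrite (reindex (fun f : {ffun 'I_n -> T} => [tuple f i | i < n])) /=; last first.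
  exists (fun t : n.-tuple T => [ffun i => tnth t i]) => x _.
    by apply/ffunP => i; rewrite ffunE tnth_mktuple.
  by apply: eq_from_tnth => i; rewrite tnth_mktuple ffunE.
by apply: eq_bigr => f _; apply: eq_bigr => i _; rewrite tnth_mktuple.
Qed.

Lemma sum_eq_natr (T : finType) (a : T) : \sum_(t : T) (t == a)%:R = 1 :> R.
Proof.
rewrite (bigD1 a) //= eqxx big1 ?addr0 // => t /negbTE -> //.
Qed.

(** For independent events of probabilities [a i], the terms are the probabilities of the disjoint
    cases that only the event [i] occurs and that none occurs. *)
Lemma exactly_one_le1 (I : eqType) (s : seq I) (a : I -> R) :
  uniq s -> (forall i, 0 <= a i <= 1) ->
  \sum_(i <- s) a i * \prod_(j <- s | j != i) (1 - a j) + \prod_(j <- s) (1 - a j) <= 1.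
Proof.
move=> + a01; elim: s => [|x s IH] /=; first by rewrite !big_nil add0r.
case/andP => xs us; rewrite !big_cons eqxx /=.
have -> : \prod_(j <- s | j != x) (1 - a j) = \prod_(j <- s) (1 - a j).
  rewrite big_seq_cond [RHS]big_seq; apply: eq_bigl => j.
  by case: (boolP (j \in s)) => //= js; apply: contraNN xs => /eqP <-.
have -> : \sum_(i <- s) a i * \prod_(j <- x :: s | j != i) (1 - a j) =
   (1 - a x) * \sum_(i <- s) a i * \prod_(j <- s | j != i) (1 - a j).
  rewrite big_seq [in RHS]big_seq mulr_sumr; apply: eq_bigr => i si.
  have xi : x != i by apply: contraNneq xs => ->.
  by rewrite big_cons xi mulrCA.
have := IH us; set S := \sum_(i <- s) _; set P := \prod_(j <- s) _ => H.
have S0 : 0 <= S.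
  apply: sumr_ge0 => i _; apply: mulr_ge0; first by case/andP: (a01 i).
  by apply: prodr_ge0 => j _; rewrite subr_ge0; case/andP: (a01 j).
have /andP[x0 x1] := a01 x.
have := mulr_ge0 x0 S0; lra.
Qed.

Lemma exists_ge_mean (T : finType) (q g : T -> R) (m : R) :
  (forall t, 0 <= q t) -> \sum_t q t = 1 -> m <= \sum_t q t * g t ->
  exists t, m <= g t.
Proof.
move=> q0 q1 mg; apply/not_existsP => /= H.
have [t qt] : exists t, 0 < q t.
  apply/not_existsP => qN; have : \sum_t q t = 0.
    apply: big1 => t _; apply/eqP; rewrite eq_le q0 andbT leNgt; apply/negP; exact: qN.
  by rewrite q1 => /eqP; rewrite oner_eq0.
suff : \sum_t q t * g t < \sum_t q t * m by rewrite -mulr_suml q1 mul1r ltNge mg.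
rewrite (bigD1 t) //= [X in _ < X](bigD1 t) //=; apply: ltr_leD.
  by rewrite ltr_pM2l // ltNge; apply/negP/H.
by apply: ler_sum => u _; apply: ler_wpM2l => //; rewrite ltW // ltNge; apply/negP/H.
Qed.

Lemma bernoulli_ge (c : R) n : 0 <= c <= 1 -> 1 - c *+ n <= (1 - c) ^+ n.
Proof.
case/andP => c0 c1; elim: n => [|n IH]; first by rewrite mulr0n subr0 expr0.
rewrite exprS.
apply: le_trans (ler_wpM2l _ IH); last by rewrite subr_ge0.
rewrite mulrS; have := mulr_ge0 c0 (mulrn_wge0 n c0); lra.
Qed.

(** Probabilistic method: the bound is the mean over random codebooks [f], so some codebook attains
    it. A wrong codeword accepts [b] with mean probability at most [1 / k], and Bernoulli's
    inequality covers the [l] wrong ones. *)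
Lemma random_coding (A B : finType) (W : A -> B -> R) (p : A -> R) (r : A -> B -> R) (k l : nat) :
  (forall a b, 0 <= W a b) ->
  (forall a b, 0 <= r a b <= p a) -> \sum_a p a = k%:R ->
  (forall b, \sum_a r a b <= 1) -> (0 < k)%N ->
  exists (f : 'I_l.+1 -> A) (d : B -> 'I_l.+1 -> R), cpmf d /\
    (k%:R^-1 * \sum_a \sum_b W a b * r a b) * (1 - l%:R / k%:R) <=
    l.+1%:R^-1 * \sum_i \sum_b W (f i) b * d b i.
Proof.
move=> W0 rp pk r1 k0.
have k0' : 0 < k%:R :> R by rewrite ltr0n.
have p0 a (b : B) : 0 <= p a by case/andP: (rp a b); exact: le_trans.
(* Nonnegativity of [p] is read off [0 <= r <= p] at some output, so an empty [B] is treated apart;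
   both sides vanish there. *)
case: (pickP (@predT B)) => [b0 _|B0]; last first.
  have [a _] : exists a : A, True.
    case: (pickP (@predT A)) => [a _|A0]; first by exists a.
    by move: pk; rewrite big_pred0 // => /esym/eqP; rewrite pnatr_eq0; case: k k0 {k0' r1}.
  exists (fun=> a), (fun b _ => 0); split.
    by split=> [b|b]; have := B0 b.
  have zB (h : B -> R) : \sum_b h b = 0 by rewrite big_pred0.
  by rewrite big1 => [|i _]; rewrite ?zB // big1 => [|i _]; rewrite ?zB // !mulr0 mul0r.
(* Division by zero yields 0; where [p a] vanishes so does [r a b], hence [pal] holds everywhere. *)
pose al a b := r a b / p a.
have al01 a b : 0 <= al a b <= 1.
  case/andP: (rp a b) => r0 rle; rewrite /al divr_ge0 ?(p0 a b) //=.
  have := p0 a b; rewrite le_eqVlt => /orP[/eqP <-|pp]; first by rewrite invr0 mulr0.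
  by rewrite ler_pdivrMr // mul1r.
have pal a b : p a * al a b = r a b.
  case: (eqVneq (p a) 0) => [pa0|pa]; last by rewrite /al mulrC divfK.
  by apply/eqP; rewrite pa0 mul0r eq_le; move: (rp a b); rewrite pa0.
pose q a := p a / k%:R.
have q0 a : 0 <= q a by rewrite divr_ge0 ?(p0 a b0) // ltW.
have q1 : \sum_a q a = 1 by rewrite -mulr_suml pk divff // gt_eqF.
pose g (f : {ffun 'I_l.+1 -> A}) b i :=
  al (f i) b * \prod_(j < l.+1 | j != i) (1 - al (f j) b).
have g0 f b i : 0 <= g f b i.
  apply: mulr_ge0; first by case/andP: (al01 (f i) b).
  by apply: prodr_ge0 => j _; rewrite subr_ge0; case/andP: (al01 (f j) b).
have g1 f b : \sum_i g f b i <= 1.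
  have := @exactly_one_le1 _ (index_enum 'I_l.+1) (fun i => al (f i) b) (index_enum_uniq _)
    (fun i => al01 (f i) b).
  apply: le_trans; rewrite lerDl; apply: prodr_ge0 => j _.
  by rewrite subr_ge0; case/andP: (al01 (f j) b).
have mean i : (k%:R^-1 * \sum_a \sum_b W a b * r a b) * (1 - l%:R / k%:R) <=
    \sum_(f : {ffun 'I_l.+1 -> A}) (\prod_j q (f j)) * \sum_b W (f i) b * g f b i.
  (* For fixed [b] the integrand is a product over codeword indices, so the sum over codebooks
     factors into one-codeword sums. *)
  rewrite (eq_bigr (fun f : {ffun 'I_l.+1 -> A} => \sum_b \prod_j
     (q (f j) * if j == i then W (f j) b * al (f j) b else 1 - al (f j) b))); last first.
    move=> f _; rewrite mulr_sumr; apply: eq_bigr => b _.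
    rewrite [RHS]big_split /=; congr (_ * _); rewrite [RHS](bigD1 i) //= eqxx -mulrA /g.
    by congr (_ * (_ * _)); apply: eq_bigr => j /negbTE ->.
  rewrite [X in _ <= X]exchange_big /=.
  have -> : k%:R^-1 * \sum_a \sum_b W a b * r a b =
     \sum_b \sum_a q a * (W a b * al a b).
    rewrite [in LHS]exchange_big /= mulr_sumr; apply: eq_bigr => b _.
    rewrite mulr_sumr; apply: eq_bigr => a _; rewrite /q -(pal a b); ring.
  rewrite mulr_suml; apply: ler_sum => b _.
  rewrite -(bigA_distr_bigA (fun j a => q a * if j == i then W a b * al a b else 1 - al a b)).
  rewrite (bigD1 i) //= eqxx; apply: ler_wpM2l.
    apply: sumr_ge0 => a _; apply: mulr_ge0 => //; apply: mulr_ge0 => //.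
    by case/andP: (al01 a b).
  have cge : 1 - k%:R^-1 <= \sum_a q a * (1 - al a b).
    rewrite (eq_bigr (fun a => q a - k%:R^-1 * r a b)); last first.
      by move=> a _; rewrite -(pal a b) /q; ring.
    by rewrite sumrB q1 -mulr_sumr lerD2l lerN2 ler_piMr ?r1 // invr_ge0 ltW.
  have c01 : 0 <= (k%:R^-1 : R) <= 1.
    by rewrite invr_ge0 (ltW k0') invf_le1 // ler1n.
  apply: (@le_trans _ _ ((1 - k%:R^-1) ^+ l)).
    by apply: le_trans (bernoulli_ge _ c01); rewrite mulr_natl.
  have -> : (1 - k%:R^-1) ^+ l = \prod_(j < l.+1 | j != i) (1 - k%:R^-1) :> R.
    rewrite prodr_const; congr (_ ^+ _).
    by have := cardC1 i; rewrite card_ord /= => {1}<-; apply: eq_card => j.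
  apply: ler_prod => j /negbTE ->; rewrite cge andbT subr_ge0.
  by case/andP: c01.
have qf1 : \sum_(f : {ffun 'I_l.+1 -> A}) \prod_j q (f j) = 1.
  by rewrite -(bigA_distr_bigA (fun _ a => q a)) big1.
have qf0 (f : {ffun 'I_l.+1 -> A}) : 0 <= \prod_j q (f j) by apply: prodr_ge0.
have [|f Hf] := @exists_ge_mean _ (fun f : {ffun 'I_l.+1 -> A} => \prod_j q (f j))
  (fun f => l.+1%:R^-1 * \sum_i \sum_b W (f i) b * g f b i)
  ((k%:R^-1 * \sum_a \sum_b W a b * r a b) * (1 - l%:R / k%:R)) qf0 qf1.
  rewrite (eq_bigr (fun f : {ffun 'I_l.+1 -> A} => \sum_i l.+1%:R^-1 *
     ((\prod_j q (f j)) * \sum_b W (f i) b * g f b i))); last first.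
    by move=> f _; rewrite mulrCA mulr_sumr mulr_sumr.
  rewrite [X in _ <= X]exchange_big /=; under [X in _ <= X]eq_bigr do rewrite -mulr_sumr.
  rewrite -mulr_sumr ler_pdivlMl ?ltr0n //.
  apply: le_trans (ler_sum _ (fun i _ => mean i)).
  by rewrite sumr_const card_ord -[X in _ <= X]mulr_natl.
(* The mass missing from [g] goes to message [ord0]: this makes the decoder a pmf and can only raise
   the success probability. *)
exists f, (fun b i => g f b i + (i == ord0)%:R * (1 - \sum_j g f b j)); split.
  split=> [b i|b].
    apply: (addr_ge0 (g0 f b i)).
    by apply: mulr_ge0; rewrite ?ler0n ?subr_ge0.
  by rewrite big_split /= -mulr_suml sum_eq_natr mul1r addrC subrK.
apply: le_trans Hf _; rewrite ler_pM2l ?invr_gt0 ?ltr0n //.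
apply: ler_sum => i _; apply: ler_sum => b _; apply: ler_wpM2l => //.
by rewrite lerDl mulr_ge0 ?ler0n // subr_ge0.
Qed.

End FiniteSums.

(** * Reduction of an assisted code to a code for one receiver *)

Section Channel.
Variables (R : realType) (X Y1 Y2 : finType) (N : X -> Y1 -> Y2 -> R).
Hypothesis Nbc : is_bc N.

Lemma chan_n_ge0 n (x : n.-tuple X) (y1 : n.-tuple Y1) (y2 : n.-tuple Y2) :
  0 <= chan_n N x y1 y2.
Proof. by apply: prodr_ge0 => i _; case: Nbc => + _; exact. Qed.

Lemma sum_chan_n n (x : n.-tuple X) :
  \sum_(y1 : n.-tuple Y1) \sum_(y2 : n.-tuple Y2) chan_n N x y1 y2 = 1.
Proof.
rewrite (eq_bigr (fun y1 : n.-tuple Y1 =>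
  \prod_(i < n) marg1 N (tnth x i) (tnth y1 i))); last first.
  by move=> y1 _; rewrite -(sum_prod_tuple (fun i => N (tnth x i) (tnth y1 i))).
rewrite (sum_prod_tuple (fun i => marg1 N (tnth x i))) big1 // => i _.
by case: Nbc => _; exact.
Qed.

Lemma nserr1_ge0 n m1 m2 Z : ns_box Z -> 0 <= @nserr1 R X Y1 Y2 N n m1 m2 Z.
Proof.
case=> Z0 _; rewrite /nserr1 mulr_ge0 ?invr_ge0 ?mulr_ge0 ?ler0n //.
do 6! (apply: sumr_ge0 => ? _); apply: mulr_ge0 => //; exact: chan_n_ge0.
Qed.

(* For fixed outputs the box averaged over [w.2] is the pair [(p, r)] of the
   point-to-point no-signaling linear program. *)
Lemma ns_user1_code n m1 m2 l
    (Z : 'I_m1 * 'I_m2 -> n.-tuple Y1 -> n.-tuple Y2 -> n.-tuple X -> 'I_m1 -> 'I_m2 -> R)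
    (y1o : n.-tuple Y1) (y2o : n.-tuple Y2) :
  ns_box Z -> (0 < m1)%N -> (0 < m2)%N ->
  exists (enc : 'I_l.+1 * 'I_1 -> n.-tuple X -> R) (dec : n.-tuple Y1 -> 'I_l.+1 -> R),
    [/\ cpmf enc, cpmf dec & cerr1 N enc dec <= nserr1 N Z + l%:R / m1%:R].
Proof.
move=> Zbox m10 m20; have e0 := nserr1_ge0 Zbox.
case: Zbox => Z0 [Z1 [Z3 [_ [_ [Z23 [Z13 _]]]]]].
have m1R : 0 < m1%:R :> R by rewrite ltr0n.
have m2R : 0 < m2%:R :> R by rewrite ltr0n.
pose wo : 'I_m1 * 'I_m2 := (Ordinal m10, Ordinal m20).
pose W (x : n.-tuple X) y1 := \sum_(y2 : n.-tuple Y2) chan_n N x y1 y2.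
have W0 x y1 : 0 <= W x y1 by apply: sumr_ge0 => y2 _; exact: chan_n_ge0.
have W1 x : \sum_y1 W x y1 = 1 by exact: sum_chan_n.
(* The transmitter's marginal is the same for all receiver inputs, so [y1o] and [y2o] serve as
   arbitrary reference words. *)
pose P w x := \sum_(v1 : 'I_m1) \sum_(v2 : 'I_m2) Z w y1o y2o x v1 v2.
pose p x := m2%:R^-1 * \sum_w P w x.
pose r x y1 := m2%:R^-1 * \sum_(w : 'I_m1 * 'I_m2) \sum_(v2 : 'I_m2) Z w y1 y2o x w.1 v2.
have rp x y1 : 0 <= r x y1 <= p x.
  apply/andP; split.
    rewrite mulr_ge0 ?invr_ge0 ?ler0n //; apply: sumr_ge0 => w _.
    by apply: sumr_ge0 => v2 _.
  rewrite ler_wpM2l ?invr_ge0 ?ler0n //; apply: ler_sum => w _.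
  rewrite /P (Z23 _ _ _ y1 y2o) (bigD1 w.1) //= lerDl.
  by apply: sumr_ge0 => v1 _; apply: sumr_ge0 => v2 _.
have P1 w : \sum_x P w x = 1 by exact: Z1.
have pk : \sum_x p x = m1%:R.
  rewrite -mulr_sumr exchange_big /= (eq_bigr (fun=> 1)); last by move=> w _; exact: P1.
  by rewrite sumr_const card_prod !card_ord natrM mulrCA mulVf ?mulr1 // gt_eqF.
(* Receiver 1's output is independent of the transmitter's input, so every [w] is replaced by [wo];
   the sum over [w.1] then exhausts a pmf, and the sum over [w.2] cancels the factor [1 / m2]. *)
have r1 y1 : \sum_x r x y1 <= 1.
  rewrite -mulr_sumr exchange_big /=.
  rewrite (eq_bigr (fun w : 'I_m1 * 'I_m2 =>
     \sum_x \sum_(v2 : 'I_m2) Z wo y1 y2o x w.1 v2)); last first.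
    by move=> w _; exact: Z13.
  rewrite -(pair_bigA _ (fun (w1 : 'I_m1) (w2 : 'I_m2) =>
     \sum_x \sum_(v2 : 'I_m2) Z wo y1 y2o x w1 v2)) /=.
  under eq_bigr do rewrite sumr_const card_ord.
  rewrite sumrMnl exchange_big /= Z1 mulVf //.
  by rewrite gt_eqF.
(* [S] is the probability that receiver 1 succeeds in the assisted code. *)
set S := m1%:R^-1 * \sum_x \sum_y1 W x y1 * r x y1.
have SE : S + nserr1 N Z = 1.
  have -> : S = (m1%:R * m2%:R)^-1 * \sum_(w : 'I_m1 * 'I_m2) \sum_(x : n.-tuple X)
     \sum_(y1 : n.-tuple Y1) \sum_(y2 : n.-tuple Y2) \sum_(v2 : 'I_m2)
       Z w y1 y2 x w.1 v2 * chan_n N x y1 y2.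
    rewrite /S invfM -mulrA; congr (_ * _).
    rewrite [in RHS]exchange_big /= mulr_sumr; apply: eq_bigr => x _.
    rewrite [in RHS]exchange_big /= mulr_sumr; apply: eq_bigr => y1 _.
    rewrite /r mulrCA; congr (_ * _); rewrite mulr_sumr; apply: eq_bigr => w _.
    rewrite /W mulr_suml; apply: eq_bigr => y2 _.
    by rewrite -mulr_suml mulrC (Z3 _ _ y2o y2).
  rewrite /nserr1 -mulrDr -big_split /=.
  rewrite (eq_bigr (fun=> 1)).
    by rewrite sumr_const card_prod !card_ord natrM mulVf // mulf_neq0 // gt_eqF.
  move=> w _; rewrite -big_split /= -[RHS](P1 w); apply: eq_bigr => x _.
  rewrite -[RHS]mulr1 -(sum_chan_n x) -big_split mulr_sumr; apply: eq_bigr => y1 _.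
  rewrite -big_split mulr_sumr; apply: eq_bigr => y2 _ /=.
  rewrite /P (Z23 _ _ _ y1 y2) mulr_suml [RHS](bigD1 w.1) //=; congr (_ + _).
    by rewrite mulr_suml.
  by apply: eq_bigr => v1 _; rewrite mulr_suml.
have [f [d [[d0 d1] H]]] := random_coding l W0 rp pk r1 m10.
exists (fun w x => (x == f w.1)%:R), d; split => //.
  by split=> [w x|w]; rewrite ?ler0n // sum_eq_natr.
have -> : cerr1 N (fun (w : 'I_l.+1 * 'I_1) x => (x == f w.1)%:R : R) d =
    1 - l.+1%:R^-1 * \sum_i \sum_b W (f i) b * d b i.
  rewrite /cerr1 mulr1.
  rewrite (eq_bigr (fun w : 'I_l.+1 * 'I_1 => 1 - \sum_b W (f w.1) b * d b w.1)).
    rewrite -(pair_bigA _ (fun (i : 'I_l.+1) (j : 'I_1) => 1 - \sum_b W (f i) b * d b i)) /=.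
    under eq_bigr do rewrite big_ord1.
    by rewrite sumrB sumr_const card_ord mulrBr mulVf // pnatr_eq0.
  move=> w _; rewrite (bigD1 (f w.1)) //= [X in _ + X]big1 ?addr0.
    have -> : (f w.1 == f w.1)%:R = 1 :> R by rewrite eqxx.
    rewrite -[X in _ = X - _](W1 (f w.1)) -sumrB; apply: eq_bigr => y1 _.
    rewrite /W mulr_suml -sumrB; apply: eq_bigr => y2 _.
    rewrite mul1r -[X in _ = X - _]mulr1 -mulrBr; congr (_ * _).
    by rewrite -[X in _ = X - _](d1 y1) [X in _ = X - _](bigD1 w.1) //= addrAC subrr add0r.
  move=> x /negbTE ->; apply: big1 => y1 _; apply: big1 => y2 _.
  by rewrite !mul0r.
move: H; rewrite -/S; set T := l.+1%:R^-1 * _ => H.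
(* With [e] the assisted error and [x = l / m1], [e x >= 0] gives [(1 - e)(1 - x) >= 1 - e - x]. *)
have /(mulr_ge0 e0) : 0 <= l%:R / m1%:R :> R by rewrite divr_ge0 ?ler0n.
move: H; have -> : S = 1 - nserr1 N Z by rewrite -SE addrK.
move: (l%:R / m1%:R) => x; lra.
Qed.

End Channel.

(** * The ratio is at most two *)

Section Rates.
Variable R : realType.
Implicit Types (x y : R) (k : nat -> nat).

Lemma log2M x y : 0 < x -> 0 < y -> log2 (x * y) = log2 x + log2 y.
Proof. by move=> x0 y0; rewrite /log2 lnM ?posrE // mulrDl. Qed.

Lemma ln2_gt0 : 0 < ln 2 :> R.
Proof. by rewrite ln_gt0 // ltr1n. Qed.

Lemma log2_2 : log2 2 = 1 :> R.
Proof. by rewrite /log2 divff // gt_eqF // ln2_gt0. Qed.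

Lemma ler_log2 x y : 0 < x -> x <= y -> log2 x <= log2 y.
Proof.
move=> x0 xy; rewrite ler_pM2r ?invr_gt0 ?ln2_gt0 // ler_ln ?posrE //.
exact: lt_le_trans xy.
Qed.

Lemma log2_1 : log2 1 = 0 :> R.
Proof. by rewrite /log2 ln1 mul0r. Qed.

Lemma log2X x n : 0 < x -> log2 (x ^+ n) = n%:R * log2 x.
Proof. by move=> x0; rewrite /log2 lnXn // -[ln x *+ n]mulr_natl mulrA. Qed.

Lemma cvg_invn : (n%:R^-1 : R) @[n --> \oo] --> (0 : R).
Proof.
apply/(@gtr0_cvgV0 _ _ _ _ (fun n : nat => n%:R : R)); last exact: cvgr_idn.
by near=> n; rewrite ltr0n; near: n; exists 1%N.
Unshelve. all: by end_near. Qed.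

(** The bound comes from [ln n = 2 ln (sqrt n) <= 2 sqrt n]. *)
Lemma cvg_log2_div : log2 (n%:R : R) / n%:R @[n --> \oo] --> (0 : R).
Proof.
apply: (@squeeze_cvgr _ _ _ _ (fun=> 0)
  (fun n : nat => 2 / ln 2 * Num.sqrt (n%:R^-1 : R))).
- near=> n.
  have n0 : (0 < n)%N by near: n; exists 1%N.
  have nR : 0 < n%:R :> R by rewrite ltr0n.
  have s0 : 0 < Num.sqrt n%:R :> R by rewrite sqrtr_gt0.
  have := @le_ln1Dx R (Num.sqrt n%:R - 1).
  rewrite addrCA subrr addr0 ltrBrDr addNr => /(_ s0) lns.
  have l2 := ln2_gt0.
  rewrite divr_ge0 ?(ltW nR) ?divr_ge0 ?ln_ge0 ?ler1n ?(ltW l2) //=.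
  rewrite sqrtrV ?(ltW nR) // ler_pdivrMr // /log2 -!mulrA.
  have -> : (Num.sqrt n%:R)^-1 * n%:R = Num.sqrt n%:R :> R.
    by rewrite -{2}(sqr_sqrtr (ltW nR)) expr2 mulKf // gt_eqF.
  have -> : 2 * ((ln 2)^-1 * Num.sqrt n%:R) = 2 * Num.sqrt n%:R / ln 2 :> R by ring.
  rewrite ler_pM2r ?invr_gt0 //.
  rewrite -{1}(sqr_sqrtr (ltW nR)) expr2 lnM ?posrE //; lra.
- exact: cvg_cst.
- rewrite -[X in _ --> X](mulr0 (2 / ln 2)); apply: cvgM; first exact: cvg_cst.
  rewrite -[X in _ --> X](@sqrtr0 R).
  apply: (@cvg_comp _ _ _ (fun n : nat => n%:R^-1 : R) Num.sqrt); first exact: cvg_invn.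
  exact: sqrt_continuous.
Unshelve. all: by end_near. Qed.

(** Cutting the message set by a factor of about [n] keeps the rate: [k / n <= k %/ n + 1 <= 2 k],
    and both [log n / n] and [1 / n] vanish. *)
Lemma cvg_log2_quot k (L : R) : (forall n, (0 < k n)%N) ->
  log2 (k n)%:R / n%:R @[n --> \oo] --> L ->
  log2 (k n %/ n).+1%:R / n%:R @[n --> \oo] --> L.
Proof.
move=> k0 kL.
apply: (@squeeze_cvgr _ _ _ _ (fun n => log2 (k n)%:R / n%:R - log2 n%:R / n%:R)
  (fun n => log2 (k n)%:R / n%:R + n%:R^-1)).
- near=> n.
  have n0 : (0 < n)%N by near: n; exists 1%N.
  have nR : 0 < n%:R^-1 :> R by rewrite invr_gt0 ltr0n.
  have -> : log2 (k n)%:R / n%:R + n%:R^-1 = (log2 (k n)%:R + 1) / n%:R :> R.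
    by rewrite mulrDl mul1r.
  rewrite -mulrBl !ler_pM2r // lerBlDr.
  have -> : log2 (k n)%:R + 1 = log2 (k n * 2)%:R :> R.
    by rewrite natrM log2M ?ltr0n // log2_2.
  rewrite -log2M ?ltr0n // -natrM; apply/andP; split; apply: ler_log2.
  + by rewrite ltr0n.
  + by rewrite ler_nat ltnW // ltn_ceil.
  + by rewrite ltr0n.
  + rewrite ler_nat muln2 -addnn -addn1 leq_add ?leq_div ?k0 //.
- by rewrite -[X in _ --> X]subr0; apply: cvgB => //; exact: cvg_log2_div.
- by rewrite -[X in _ --> X]addr0; apply: cvgD => //; exact: cvg_invn.
Unshelve. all: by end_near. Qed.

End Rates.

(** * Exchanging the two receivers *)

Section Swap.
Variables (R : realType) (X Y1 Y2 : finType) (N : X -> Y1 -> Y2 -> R).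

Let Ns x y2 y1 := N x y1 y2.

Lemma sum_swap (A B : finType) (F : A * B -> R) :
  \sum_w F w = \sum_(w : B * A) F (w.2, w.1).
Proof.
rewrite (reindex (fun w : B * A => (w.2, w.1))) //=.
by exists (fun w : A * B => (w.2, w.1)) => -[].
Qed.

Lemma is_bc_swap : is_bc N -> is_bc Ns.
Proof. by case=> N0 N1; split=> [x y2 y1|x]; [exact: N0|rewrite exchange_big; exact: N1]. Qed.

(** The map [s] relabels the transmitter's input, because exchanging the receivers also exchanges
    the two messages. *)
Lemma ns_box_swap (A1 A1' A2 A3 B1 B2 B3 : finType) (s : A1' -> A1)
    (Z : A1 -> A2 -> A3 -> B1 -> B2 -> B3 -> R) :
  ns_box Z -> ns_box (fun a1 a3 a2 b1 b3 b2 => Z (s a1) a2 a3 b1 b2 b3).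
Proof.
case=> [Z0 [Z1 [Z3 [Z2 [Zx [Z23 [Z13 Z12]]]]]]].
split=> [*|]; first exact: Z0.
split=> [a1 a3 a2|]; first by rewrite -(Z1 (s a1) a2 a3); apply: eq_bigr => *; exact: exchange_big.
split=> [*|]; first exact: Z2.
split=> [*|]; first exact: Z3.
split=> [*|]; first exact: Zx.
split=> [a1 a3 a2 a3' a2' b1|].
  by rewrite exchange_big (Z23 _ _ _ a2' a3') exchange_big.
by split=> [a1 a3 a2 a1' a2' b3|a1 a3 a2 a1' a3' b2]; [exact: Z12|exact: Z13].
Qed.

Lemma rates_ok_swap k1 k2 (r : R * R) : rates_ok k1 k2 r -> rates_ok k2 k1 (r.2, r.1).
Proof. by case=> L1 [L2 [? [? [? ?]]]]; exists L2, L1. Qed.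

Lemma cerr_swap n m1 m2 enc (dec1 : n.-tuple Y1 -> 'I_m1 -> R)
    (dec2 : n.-tuple Y2 -> 'I_m2 -> R) (enc' := fun w => enc (w.2, w.1)) :
  cerr1 Ns enc' dec2 = cerr2 N enc dec2 /\ cerr2 Ns enc' dec1 = cerr1 N enc dec1.
Proof.
rewrite /cerr1 /cerr2 [m2%:R * _]mulrC; split; congr (_ * _); rewrite [RHS]sum_swap /=;
  by apply: eq_bigr => w _; apply: eq_bigr => x _; rewrite exchange_big.
Qed.

Lemma nserr_swap n m1 m2 Z (Z' := fun w y2 y1 x v2 v1 => Z (w.2, w.1) y1 y2 x v1 v2) :
  @nserr1 R X Y2 Y1 Ns n m2 m1 Z' = @nserr2 R X Y1 Y2 N n m1 m2 Z /\
  @nserr2 R X Y2 Y1 Ns n m2 m1 Z' = @nserr1 R X Y1 Y2 N n m1 m2 Z.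
Proof.
rewrite /nserr1 /nserr2 [m2%:R * _]mulrC; split; congr (_ * _); rewrite [RHS]sum_swap /=;
  apply: eq_bigr => w _; apply: eq_bigr => x _; rewrite exchange_big /=;
  by do 2! (apply: eq_bigr => ? _); rewrite exchange_big.
Qed.

Lemma c_achievable_swap (r : R * R) : c_achievable N r -> c_achievable Ns (r.2, r.1).
Proof.
case=> m1 [m2 [enc [dec1 [dec2 [m0 [ce [cd1 [cd2 [err ro]]]]]]]]].
exists m2, m1, (fun n w => enc n (w.2, w.1)), dec2, dec1.
split=> [n|]; first by case: (m0 n).
split=> [n|]; first by split=> [w x|w]; case: (ce n).
do 2! split => //; split; last exact: rates_ok_swap.
suff -> : (fun n => Num.max (cerr1 Ns (fun w => enc n (w.2, w.1)) (dec2 n))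
    (cerr2 Ns (fun w => enc n (w.2, w.1)) (dec1 n))) =
  (fun n => Num.max (cerr1 N (enc n) (dec1 n)) (cerr2 N (enc n) (dec2 n))) by [].
apply: funext => n; have [-> ->] := cerr_swap (enc n) (dec1 n) (dec2 n).
exact: maxC.
Qed.

Lemma ns_achievable_swap (r : R * R) : ns_achievable N r -> ns_achievable Ns (r.2, r.1).
Proof.
case=> m1 [m2 [Z [m0 [Zb [err ro]]]]].
exists m2, m1, (fun n w y2 y1 x v2 v1 => Z n (w.2, w.1) y1 y2 x v1 v2).
split=> [n|]; first by case: (m0 n).
split=> [n|]; first exact: (ns_box_swap (fun w => (w.2, w.1)) (Zb n)).
split; last exact: rates_ok_swap.
suff -> : (fun n => Num.max (nserr1 Ns (fun w y2 y1 x v2 v1 => Z n (w.2, w.1) y1 y2 x v1 v2))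
    (nserr2 Ns (fun w y2 y1 x v2 v1 => Z n (w.2, w.1) y1 y2 x v1 v2))) =
  (fun n => Num.max (nserr1 N (Z n)) (nserr2 N (Z n))) by [].
apply: funext => n; have [-> ->] := nserr_swap (Z n).
exact: maxC.
Qed.

End Swap.

(** With [l = m1 n %/ n] the extra error is at most [1 / n]. Receiver 2 gets a single message and
    never errs. *)
Lemma ns_user1_achievable (R : realType) (X Y1 Y2 : finType) (N : X -> Y1 -> Y2 -> R)
    (r : R * R) (y1o : Y1) (y2o : Y2) :
  is_bc N -> ns_achievable N r -> exists2 L, r.1 <= L & c_achievable N (L, 0).
Proof.
move=> Nbc [m1 [m2 [Z [m0 [Zb [err [L1 [L2 [c1 [c2 [r1 r2]]]]]]]]]]].
exists L1 => //.
have H n : exists e : ('I_(m1 n %/ n).+1 * 'I_1 -> n.-tuple X -> R) *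
    (n.-tuple Y1 -> 'I_(m1 n %/ n).+1 -> R),
    [/\ cpmf e.1, cpmf e.2 & cerr1 N e.1 e.2 <= nserr1 N (Z n) + (m1 n %/ n)%:R / (m1 n)%:R].
  have [m10 m20] := m0 n.
  have [enc [dec]] := ns_user1_code Nbc (m1 n %/ n) (nseq_tuple n y1o) (nseq_tuple n y2o) (Zb n) m10 m20.
  by exists (enc, dec).
pose e n := sval (cid (H n)).
have eP n := svalP (cid (H n)).
pose dec2 n (_ : n.-tuple Y2) (_ : 'I_1) : R := 1.
exists (fun n => (m1 n %/ n).+1), (fun=> 1%N), (fun n => (e n).1), (fun n => (e n).2), dec2.
split=> [//|].
split=> [n|]; first by have [] := eP n.
split=> [n|]; first by have [] := eP n.
split=> [n|]; first by split=> *; rewrite ?ler01 // big_ord1.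
have c2E n : cerr2 N (e n).1 (dec2 n) = 0.
  rewrite /cerr2 big1 ?mulr0 // => w _; do 3! (apply: big1 => ? _).
  by rewrite big_pred0 ?mulr0 // => v; rewrite [v]ord1 [w.2]ord1 eqxx.
have c1ge n : 0 <= cerr1 N (e n).1 (e n).2.
  have [[e0 _] [d0 _] _] := eP n.
  rewrite mulr_ge0 ?invr_ge0 ?mulr_ge0 ?ler0n //.
  do 4! (apply: sumr_ge0 => ? _); rewrite mulr_ge0 ?mulr_ge0 ?sumr_ge0 //.
  exact: chan_n_ge0.
split; last first.
  exists L1, 0; split; last split => //=.
    by apply: cvg_log2_quot => // n; case: (m0 n).
  under eq_fun do rewrite log2_1 mul0r.
  exact: cvg_cst.
apply: (@squeeze_cvgr _ _ _ _ (fun=> 0)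
   (fun n => Num.max (nserr1 N (Z n)) (nserr2 N (Z n)) + n%:R^-1)).
- near=> n.
  rewrite c2E (max_idPl (c1ge n)) c1ge /=.
  have [_ _ /le_trans] := eP n; apply; apply: lerD; first by rewrite le_max lexx.
  have [m10 _] := m0 n.
  have n0 : (0 < n)%N by near: n; exists 1%N.
  rewrite ler_pdivrMr ?ltr0n // mulrC ler_pdivlMr ?ltr0n // -natrM ler_nat.
  exact: leq_divM.
- exact: cvg_cst.
- by rewrite -[X in _ --> X]addr0; apply: cvgD => //; exact: cvg_invn.
Unshelve. all: by end_near. Qed.

Lemma closure_sum_le (R : realType) (A : set (R * R)) c :
  (forall r, A r -> r.1 + r.2 <= c) -> forall r, closure A r -> r.1 + r.2 <= c.
Proof.
move=> Ac r Ar.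
have cl : closed [set r : R * R | r.1 + r.2 <= c].
  rewrite (_ : [set _ | _] = (fun r : R * R => r.1 + r.2) @^-1` [set x | x <= c]) //.
  apply: preimage_closed; last exact: closed_le.
  by move=> x _; apply: cvgD; [exact: cvg_fst|exact: cvg_snd].
by have := closureS Ac Ar; rewrite -(closure_id _).1.
Qed.

(** * Comparison of the two sum-capacities *)

Section Capacity.
Variables (R : realType) (X Y1 Y2 : finType) (N : X -> Y1 -> Y2 -> R).
Hypothesis Nbc : is_bc N.

Let rate_sums : set R := [set r.1 + r.2 | r in cap_region N].

Lemma ns_sum_le_twice (r : R * R) (x : X) :
  has_ubound rate_sums -> ns_achievable N r -> r.1 + r.2 <= 2 * sum_cap N.
Proof.
move=> ub rN.
have [y1o [y2o _]] : exists (y1 : Y1) (y2 : Y2), True.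
  apply: contrapT => H; case: Nbc => _ /(_ x).
  rewrite big1 => [/esym/eqP|y1 _]; first by rewrite oner_eq0.
  by apply: big1 => y2 _; exfalso; apply: H; exists y1, y2.
have le r' : c_achievable N r' -> r'.1 + r'.2 <= sum_cap N.
  by move=> r'N; apply: ub_le_sup => //; exists r' => //; exact: subset_closure.
have [L1 rL1 /le /=] := ns_user1_achievable y1o y2o Nbc rN.
(* For receiver 2 the reduction is made on the swapped channel and its code is swapped back. *)
have [L2 /= rL2 /c_achievable_swap/le /=] :=
  ns_user1_achievable y2o y1o (is_bc_swap Nbc) (ns_achievable_swap rN).
by lra.
Qed.

Lemma has_ns_ubound (x : X) : has_ubound rate_sums ->
  ubound [set r.1 + r.2 | r in ns_cap_region N] (2 * sum_cap N).
Proof.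
move=> ub _ [r rN <-]; apply: closure_sum_le rN => r'.
exact: ns_sum_le_twice.
Qed.

Lemma ns_sum_cap_le_twice : 0 < sum_cap N -> ns_sum_cap N <= 2 * sum_cap N.
Proof.
move=> s0.
(* [sup] is 0 on a set that is empty or unbounded above, so a positive [sum_cap] yields both
   nonemptiness and a bound. *)
have [[_ [r0 r0c _]] ub] : has_sup rate_sums.
  apply: contrapT => /sup_out s; move: s0; by rewrite /sum_cap s ltxx.
have [r [rN _]] := r0c _ filterT.
case: rN => m1 [m2 [enc [_ [_ [m0 [ce _]]]]]].
(* An encoder of block length 1 must emit some letter. *)
have [x _] : exists x : X, True.
  have [m10 m20] := m0 1%N.
  apply: contrapT => H; have [_ /(_ (Ordinal m10, Ordinal m20))] := ce 1%N.
  rewrite big1 => [/esym/eqP|t _]; first by rewrite oner_eq0.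
  by exfalso; apply: H; exists (tnth t ord0).
have [ne|e0] := pselect ([set r.1 + r.2 | r in ns_cap_region N] !=set0).
  by apply: ge_sup => //; exact: has_ns_ubound.
have -> : ns_sum_cap N = 0 by apply: sup_out => -[].
by rewrite mulr_ge0 // ltW.
Qed.

End Capacity.

(** * A channel with ratio close to two *)

Section Converse.
Variable R : realType.

(** Expands [(lam d - f)^2 >= 0] and uses [d^2 <= d]; [lam] is left free to balance the two terms
    later. *)
Lemma amgm_le (d f lam : R) : 0 <= d <= 1 -> 0 < lam ->
  2 * (d * f) <= lam * d + f ^+ 2 / lam.
Proof.
case/andP=> d0 d1 lam0.
have sq : 0 <= (lam * d - f) ^+ 2 / lam by rewrite divr_ge0 ?sqr_ge0 // ltW.
have -> : f ^+ 2 / lam = (lam * d - f) ^+ 2 / lam + 2 * (d * f) - lam * d ^+ 2.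
  by field; rewrite gt_eqF.
have : lam * d ^+ 2 <= lam * d by rewrite ler_pM2l // expr2 ler_piMl.
lra.
Qed.

(** Second moment method. Receiver 1 sees [sg a], receiver 2 sees [y] with law [kap a], and [K]
    bounds the correlation of two such laws. [f w2 y] is the weight of the outcome [y] with [w1]
    decoded correctly; [amgm_le] trades its overlap with [d2] for its square sum. *)
Lemma joint_success_le (A S Y W1 W2 : finType) (sg : A -> S) (kap : A -> Y -> R)
    (e : W1 -> W2 -> A -> R) (d1 : S -> W1 -> R) (d2 : Y -> W2 -> R)
    (K : S -> S -> R) (t lam : R) :
  (forall w1 w2 a, 0 <= e w1 w2 a) -> (forall w1 w2, \sum_a e w1 w2 a = 1) ->
  cpmf d1 -> cpmf d2 -> 0 < lam ->
  (forall s s', 0 <= K s s') -> (forall s, \sum_s' K s s' <= t) ->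
  (forall a a', \sum_y kap a y * kap a' y <= K (sg a) (sg a')) ->
  2 * (\sum_w2 \sum_y d2 y w2 * \sum_w1 \sum_a e w1 w2 a * d1 (sg a) w1 * kap a y)
    <= lam * #|Y|%:R + (#|W1| * #|W2|)%:R * t / lam.
Proof.
move=> e0 e1 [d10 d11] [d20 d21] lam0 K0 Kt kK.
have d1le s w : d1 s w <= 1.
  by rewrite -(d11 s) (bigD1 w) //= lerDl sumr_ge0.
have d2le y w : d2 y w <= 1.
  by rewrite -(d21 y) (bigD1 w) //= lerDl sumr_ge0.
pose f w2 y := \sum_w1 \sum_a e w1 w2 a * d1 (sg a) w1 * kap a y.
(* Inputs are grouped by what receiver 1 sees; since [d1 s'] sums to 1 over [w1], the bound does not
   grow with the number of messages. *)
have Kin s w2 : \sum_w1 \sum_a e w1 w2 a * d1 (sg a) w1 * K s (sg a) <= t.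
  apply: le_trans (Kt s).
  have H w1 : \sum_a e w1 w2 a * d1 (sg a) w1 * K s (sg a) <= \sum_s' d1 s' w1 * K s s'.
    rewrite (partition_big sg predT) //=; apply: ler_sum => s' _.
    rewrite (eq_bigr (fun a => e w1 w2 a * (d1 s' w1 * K s s'))); last first.
      by move=> a /eqP ->; rewrite mulrA.
    rewrite -mulr_suml ler_piMl ?mulr_ge0 //.
    rewrite -(e1 w1 w2) [X in _ <= X](bigID (fun a => sg a == s')) /= lerDl.
    exact: sumr_ge0.
  apply: le_trans (ler_sum _ (fun w1 _ => H w1)) _.
  rewrite exchange_big /=; apply: ler_sum => s' _.
  by rewrite -mulr_suml d11 mul1r.
have t0 : forall a : A, 0 <= t.
  by move=> a; apply: le_trans (Kt (sg a)); apply: sumr_ge0.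
have f2 w2 : \sum_y f w2 y ^+ 2 <= #|W1|%:R * t.
  pose c w1 a := e w1 w2 a * d1 (sg a) w1.
  have c0 w1 a : 0 <= c w1 a by rewrite mulr_ge0.
  (* The square becomes a sum over pairs of message and input; [K] bounds each correlation, [Kin]
     the inner sum, and the outer weights add up to at most [#|W1|]. *)
  have -> : \sum_y f w2 y ^+ 2 = \sum_w1 \sum_a c w1 a * \sum_w1' \sum_a'
      c w1' a' * \sum_y kap a y * kap a' y.
    rewrite (eq_bigr (fun y => \sum_w1 \sum_a c w1 a * \sum_w1' \sum_a'
        c w1' a' * (kap a y * kap a' y))); last first.
      move=> y _; rewrite expr2 {1}/f mulr_suml; apply: eq_bigr => w1 _.
      rewrite mulr_suml; apply: eq_bigr => a _; rewrite -/(c w1 a) -mulrA.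
      congr (_ * _); rewrite /f mulr_sumr; apply: eq_bigr => w1' _.
      rewrite mulr_sumr; apply: eq_bigr => a' _; rewrite -/(c w1' a'); ring.
    rewrite exchange_big; apply: eq_bigr => w1 _.
    rewrite exchange_big; apply: eq_bigr => a _.
    rewrite -mulr_sumr; congr (_ * _).
    rewrite exchange_big; apply: eq_bigr => w1' _.
    rewrite exchange_big; apply: eq_bigr => a' _.
    by rewrite -mulr_sumr.
  apply: (@le_trans _ _ (\sum_w1 \sum_a c w1 a * t)).
    apply: ler_sum => w1 _; apply: ler_sum => a _; apply: ler_wpM2l => //.
    apply: le_trans (Kin (sg a) w2).
    by apply: ler_sum => w1' _; apply: ler_sum => a' _; apply: ler_wpM2l.
  apply: (@le_trans _ _ (\sum_(w1 : W1) t)); last by rewrite sumr_const mulr_natl.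
  apply: ler_sum => w1 _.
  case: (pickP (@predT A)) => [a _|A0]; last first.
    by move/eqP: (e1 w1 w2); rewrite big_pred0 // eq_sym oner_eq0.
  rewrite -mulr_suml ler_piMl ?(t0 a) // -(e1 w1 w2).
  by apply: ler_sum => b _; rewrite ler_piMr.
have am w2 y : 2 * (d2 y w2 * f w2 y) <= lam * d2 y w2 + f w2 y ^+ 2 / lam.
  by apply: amgm_le; rewrite ?d20 ?d2le.
have step w2 : 2 * (\sum_y d2 y w2 * f w2 y) <= lam * \sum_y d2 y w2 + #|W1|%:R * t / lam.
  rewrite mulr_sumr; apply: le_trans (ler_sum _ (fun y _ => am w2 y)) _.
  by rewrite big_split /= -mulr_sumr -mulr_suml lerD2l ler_pM2r ?invr_gt0.
rewrite mulr_sumr; apply: le_trans (ler_sum _ (fun w2 _ => step w2)) _.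
rewrite big_split /= -mulr_sumr exchange_big /=.
rewrite [X in lam * X](eq_bigr (fun=> 1)) // !sumr_const.
rewrite -[X in _ + X]mulr_natl natrM; by rewrite le_eqVlt; apply/orP; left; apply/eqP; ring.
Qed.

End Converse.

(** * The line channel and its unassisted converse *)

Section LineChannel.
Variables (R : realType) (F : finFieldType).
Let q : R := #|F|%:R.

Definition line_ch (x : F * F) (y1 : F) (y2 : F * F) : R :=
  (y1 == x.1)%:R * (y2.1 + x.1 * y2.2 == x.2)%:R / q.

Lemma card_gt1 : 1 < q.
Proof. by rewrite ltr1n; rewrite (cardD1 0) (cardD1 1) !inE oner_eq0. Qed.

Let q0 : 0 < q.
Proof. exact: lt_trans ltr01 card_gt1. Qed.

Lemma sum_eqB (c v : F) : \sum_(a : F) (a + c == v)%:R = 1 :> R.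
Proof.
rewrite -[RHS](sum_eq_natr R (v - c)); apply: eq_bigr => a _.
by rewrite eq_sym -subr_eq eq_sym.
Qed.

Lemma line_sum (s v : F) : \sum_(y2 : F * F) (y2.1 + s * y2.2 == v)%:R = q.
Proof.
rewrite -(pair_bigA _ (fun a b => (a + s * b == v)%:R)) exchange_big /=.
by under eq_bigr do rewrite sum_eqB; rewrite sumr_const.
Qed.

Lemma line_marg1 x y1 : marg1 line_ch x y1 = (y1 == x.1)%:R.
Proof. by rewrite /marg1 -mulr_suml -mulr_sumr line_sum mulfK // gt_eqF. Qed.

Lemma line_bc : is_bc line_ch.
Proof.
split=> [x y1 y2|x]; first by rewrite /line_ch !mulr_ge0 ?ler0n // invr_ge0 ltW.
by under eq_bigr do rewrite -/(marg1 line_ch x _) line_marg1; rewrite sum_eq_natr.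
Qed.

Lemma line_semidet : semidet line_ch.
Proof. by left=> x y1; rewrite line_marg1; case: eqP; [right|left]. Qed.

Definition line_weight (s s' : F) : R := if s == s' then q else 1.

(** Counts common points: two lines of equal slope share at most the [q] points of one line, two of
    distinct slopes meet in one point. *)
Lemma line_pair_sum (s v s' v' : F) :
  \sum_(y2 : F * F) (y2.1 + s * y2.2 == v)%:R * (y2.1 + s' * y2.2 == v')%:R
    <= line_weight s s'.
Proof.
rewrite /line_weight; have [_|ss] := eqVneq.
  rewrite -(line_sum s v); apply: ler_sum => y _.
  by rewrite ler_piMr ?ler0n // lern1 leq_b1.
(* The point named here is the intersection of the two lines, solved for [b] first. *)
rewrite -[leRHS](sum_eq_natr R (v - s * ((v' - v) / (s' - s)), (v' - v) / (s' - s))).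
apply: ler_sum => -[a b] _ /=; rewrite -natrM mulnb ler_nat.
have [/= /eqP e1|//] := boolP (a + s * b == v).
have [/eqP e2|//] := boolP (a + s' * b == v').
have d0 : s' - s != 0 by rewrite subr_eq0 eq_sym.
have -> : (v' - v) / (s' - s) = b by rewrite -e1 -e2; field.
by rewrite -e1 addrK eqxx.
Qed.

(** The diagonal contributes [q], the other slopes 1 each; this [2 q] becomes the bound [log (2 q)]
    on the sum-capacity. *)
Lemma sum_line_weight s : \sum_s' line_weight s s' <= 2 * q.
Proof.
apply: (@le_trans _ _ (\sum_s' ((s' == s)%:R * q + 1))).
  apply: ler_sum => s' _; rewrite /line_weight eq_sym.
  by case: eqP => _; rewrite ?mul1r ?mul0r ?add0r ?lerDl.
by rewrite big_split /= -mulr_suml sum_eq_natr sumr_const mul1r mulr_natl mulr2n.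
Qed.

(** The law of receiver 2's block given the input block [x]. *)
Definition line_out n (x : n.-tuple (F * F)) (y2 : n.-tuple (F * F)) : R :=
  \prod_(i < n) (((tnth y2 i).1 + (tnth x i).1 * (tnth y2 i).2 == (tnth x i).2)%:R / q).

Lemma line_chan_n n (x : n.-tuple (F * F)) y1 y2 :
  chan_n line_ch x y1 y2 = (y1 == map_tuple fst x)%:R * line_out x y2.
Proof.
rewrite /chan_n (eq_bigr (fun i => (tnth y1 i == (tnth x i).1)%:R *
   (((tnth y2 i).1 + (tnth x i).1 * (tnth y2 i).2 == (tnth x i).2)%:R / q)));
  last by move=> i _; rewrite /line_ch mulrA.
rewrite big_split /=; congr (_ * _).
have [->|ne] := eqVneq y1 (map_tuple fst x).
  by apply: big1 => i _; rewrite tnth_map eqxx.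
have [i /negbTE ni] : exists i, tnth y1 i != (tnth x i).1.
  apply: contrapT => /forallNP H; case/eqP: ne; apply: eq_from_tnth => i.
  by rewrite tnth_map; apply/eqP/negbNE/negP; exact: H.
by rewrite (bigD1 i) //= ni mul0r.
Qed.

Lemma line_out_pair_sum n (x x' : n.-tuple (F * F)) :
  \sum_y line_out x y * line_out x' y <=
  \prod_(i < n) (line_weight (tnth (map_tuple fst x) i) (tnth (map_tuple fst x') i) / q ^+ 2).
Proof.
pose G i y : R := (y.1 + (tnth x i).1 * y.2 == (tnth x i).2)%:R / q *
  ((y.1 + (tnth x' i).1 * y.2 == (tnth x' i).2)%:R / q).
rewrite (eq_bigr (fun y : n.-tuple (F * F) => \prod_(i < n) G i (tnth y i))); last first.
  by move=> y _; rewrite -big_split.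
rewrite sum_prod_tuple; apply: ler_prod => i _; apply/andP; split.
  apply: sumr_ge0 => y _.
  by apply: mulr_ge0; rewrite divr_ge0 ?ler0n // ltW.
rewrite !tnth_map (eq_bigr (fun y =>
  ((y.1 + (tnth x i).1 * y.2 == (tnth x i).2)%:R *
  (y.1 + (tnth x' i).1 * y.2 == (tnth x' i).2)%:R) / q ^+ 2)); last first.
  by move=> y _; rewrite /G; field; rewrite gt_eqF.
by rewrite -mulr_suml ler_pM2r ?invr_gt0 ?exprn_gt0 // line_pair_sum.
Qed.

Lemma line_one_shot_converse n m1 m2 (enc : 'I_m1 * 'I_m2 -> n.-tuple (F * F) -> R)
    (dec1 : n.-tuple F -> 'I_m1 -> R) (dec2 : n.-tuple (F * F) -> 'I_m2 -> R) :
  (0 < m1)%N -> (0 < m2)%N -> cpmf enc -> cpmf dec1 -> cpmf dec2 ->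
  1 - (cerr1 line_ch enc dec1 + cerr2 line_ch enc dec2) <=
    2^-1 * (1 + (2 * q) ^+ n / (m1 * m2)%:R).
Proof.
move=> m10 m20 cenc cd1 cd2; have [e0 e1] := cenc; have [d10 d11] := cd1; have [d20 d21] := cd2.
have mR : 0 < (m1 * m2)%:R :> R by rewrite ltr0n muln_gt0 m10.
have d1le y w : dec1 y w <= 1 by rewrite -(d11 y) (bigD1 w) //= lerDl sumr_ge0.
have d2le y w : dec2 y w <= 1 by rewrite -(d21 y) (bigD1 w) //= lerDl sumr_ge0.
pose M : R := (m1 * m2)%:R.
pose P := \sum_(w : 'I_m1 * 'I_m2) \sum_x \sum_y1 \sum_y2
  enc w x * chan_n line_ch x y1 y2 * (dec1 y1 w.1 * dec2 y2 w.2).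
(* Union bound with [P / M] the joint success probability; termwise it is
   [(1 - d1)(1 - d2) >= 0]. *)
have Pge : 1 - (cerr1 line_ch enc dec1 + cerr2 line_ch enc dec2) <= M^-1 * P.
  rewrite lerBlDr /cerr1 /cerr2 -natrM -!mulrDr ler_pdivlMl // mulr1.
  rewrite /P -!big_split /=.
  have -> : M = \sum_(w : 'I_m1 * 'I_m2) 1.
    by rewrite sumr_const card_prod !card_ord.
  apply: ler_sum => w _; rewrite -!big_split /= -[leLHS](e1 w).
  apply: ler_sum => x _; rewrite -!big_split /=.
  rewrite -[leLHS]mulr1 -[in leLHS](sum_chan_n line_bc x) mulr_sumr.
  apply: ler_sum => y1 _; rewrite -!big_split /= mulr_sumr.
  apply: ler_sum => y2 _; rewrite -!mulrDr -[leLHS]mulr1.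
  apply: ler_wpM2l; first by rewrite mulr_ge0 // chan_n_ge0 //; exact: line_bc.
  have := d11 y1; rewrite (bigD1 w.1) //= => /(canRL (addKr _)) ->.
  have := d21 y2; rewrite (bigD1 w.2) //= => /(canRL (addKr _)) ->.
  have : 0 <= (1 - dec1 y1 w.1) * (1 - dec2 y2 w.2) by rewrite mulr_ge0 ?subr_ge0.
  lra.
apply: (le_trans Pge); rewrite ler_pdivrMl // mulrCA ler_pdivlMl //.
(* Receiver 1's output is a function of the input, so the sum over [y1] has one nonzero term. *)
have -> : P = \sum_w2 \sum_y dec2 y w2 * \sum_w1 \sum_x
   enc (w1, w2) x * dec1 (map_tuple fst x) w1 * line_out x y.
  transitivity (\sum_w1 \sum_w2 \sum_x \sum_y1 \sum_y2
    enc (w1, w2) x * chan_n line_ch x y1 y2 * (dec1 y1 w1 * dec2 y2 w2)).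
    by rewrite pair_bigA /=; apply: eq_bigr => -[w1 w2] _.
  rewrite exchange_big /=; apply: eq_bigr => w2 _.
  under [RHS]eq_bigr do rewrite mulr_sumr.
  rewrite [RHS]exchange_big /=; apply: eq_bigr => w1 _.
  under [RHS]eq_bigr do rewrite mulr_sumr.
  rewrite [RHS]exchange_big /=; apply: eq_bigr => x _.
  rewrite exchange_big /=; apply: eq_bigr => y _.
  rewrite (bigD1 (map_tuple fst x)) //= big1 ?addr0.
    by rewrite line_chan_n eqxx mulr1n mul1r; ring.
  by move=> y1 /negbTE ne; rewrite line_chan_n ne mulr0n mul0r mulr0 mul0r.
have nY : #|{: n.-tuple (F * F)}|%:R = q ^+ 2 ^+ n :> R.
  by rewrite card_tuple card_prod natrX natrM -expr2.
pose K (s s' : n.-tuple F) : R := \prod_(i < n) (line_weight (tnth s i) (tnth s' i) / q ^+ 2).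
have lw0 s s' : 0 <= line_weight s s' / q ^+ 2.
  rewrite divr_ge0 ?exprn_ge0 ?ltW // /line_weight; case: ifP => _ //.
(* The choice [lam = M / q^(2n)] turns the two terms into [M] and [(2 q)^n]. *)
have := @joint_success_le R _ _ _ _ _ (fun x : n.-tuple (F * F) => map_tuple fst x)
  (@line_out n) (fun w1 w2 => enc (w1, w2)) dec1 dec2 K ((2 * q / q ^+ 2) ^+ n)
  (M / q ^+ 2 ^+ n).
rewrite nY !card_ord -/M.
have -> : M / q ^+ 2 ^+ n * q ^+ 2 ^+ n + M * (2 * q / q ^+ 2) ^+ n / (M / q ^+ 2 ^+ n) =
  M * (1 + (2 * q) ^+ n / M).
  have q2 : q ^+ 2 ^+ n != 0 by rewrite !expf_neq0 // gt_eqF.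
  have M0 : M != 0 by rewrite gt_eqF.
  rewrite expr_div_n; move: M0 q2.
  by move: (M) (q ^+ 2 ^+ n) ((2 * q) ^+ n) => x y z x0 y0; field; rewrite x0 y0.
apply => //.
- by rewrite divr_gt0 // !exprn_gt0.
- by move=> s s'; apply: prodr_ge0.
- move=> s; rewrite (sum_prod_tuple (fun i t => line_weight (tnth s i) t / q ^+ 2)).
  have -> : (2 * q / q ^+ 2) ^+ n = \prod_(i < n) (2 * q / q ^+ 2).
    by rewrite prodr_const card_ord.
  apply: ler_prod => i _.
  rewrite sumr_ge0 //= -mulr_suml ler_pM2r ?invr_gt0 ?exprn_gt0 //.
  exact: sum_line_weight.
- exact: line_out_pair_sum.
Qed.

Lemma line_converse (r : R * R) :
  c_achievable line_ch r -> r.1 + r.2 <= log2 (2 * q).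
Proof.
case=> m1 [m2 [enc [dec1 [dec2 [m0 [ce [cd1 [cd2 [err [L1 [L2 [c1 [c2 [r1 r2]]]]]]]]]]]]]].
apply: le_trans (lerD r1 r2) _.
apply: (@ler_cvg_to _ \oo _ _ (fun n => log2 (m1 n)%:R / n%:R + log2 (m2 n)%:R / n%:R)
   (fun n => log2 (2 * q) + n%:R^-1)).
- exact: cvgD.
- by rewrite -[X in _ --> X]addr0; apply: cvgD; [exact: cvg_cst|exact: cvg_invn].
(* Errors of at most 1/8 each give [3/4 <= (1 + T) / 2], so [T >= 1/2] and [m1 m2 <= 2 (2 q)^n]; the
   factor 2 costs [1 / n] in rate. *)
have /cvgr0Pnorm_le/(_ 8^-1) errn := err.
near=> n.
have n0 : (0 < n)%N by near: n; exists 1%N.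
have nR : 0 < n%:R :> R by rewrite ltr0n.
have En : `|Num.max (cerr1 line_ch (enc n) (dec1 n)) (cerr2 line_ch (enc n) (dec2 n))| <= 8^-1.
  by near: n; apply: errn; rewrite invr_gt0.
have [m10 m20] := m0 n.
have /(le_trans (ler_norm _)) := En; rewrite ge_max => /andP[E1 E2].
have := line_one_shot_converse m10 m20 (ce n) (cd1 n) (cd2 n).
have mR : 0 < (m1 n * m2 n)%:R :> R by rewrite ltr0n muln_gt0 m10.
set T := _ / (m1 n * m2 n)%:R => H.
have : 2^-1 <= T by move: H E1 E2; lra.
rewrite ler_pdivlMr // mulrC ler_pdivrMr // => Hm.
rewrite -mulrDl ler_pdivrMr // mulrDl mulVf ?gt_eqF // -log2M ?ltr0n // -natrM.
have q20 : 0 < 2 * q by rewrite mulr_gt0.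
rewrite mulrC -log2X // -[X in _ + X]log2_2 -log2M ?exprn_gt0 //.
exact: ler_log2.
Unshelve. all: by end_near. Qed.

End LineChannel.

(** * Zero-error assisted code for the line channel *)

Section NonSignaling.
Variable R : realType.

(* A uniform shared pad hides from receiver 2 the transmitter's input. *)
Lemma pad_ns_box (W V1 V2 A B1 B2 P : finType) (fx : W -> P -> A) (f1 : V1 -> B1)
    (f2 : W -> V2 -> P -> B2) :
  (0 < #|P|)%N -> (forall w y2 v, \sum_p (v == f2 w y2 p)%:R = 1 :> R) ->
  ns_box (fun w y1 y2 x v1 v2 => #|P|%:R^-1 *
    \sum_(p : P) (x == fx w p)%:R * ((v1 == f1 y1)%:R * (v2 == f2 w y2 p)%:R) : R).
Proof.
move=> P0 f2P; set Z := (fun w => _).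
have S3 w y1 y2 x v1 : \sum_v2 Z w y1 y2 x v1 v2 =
    #|P|%:R^-1 * \sum_p (x == fx w p)%:R * (v1 == f1 y1)%:R.
  rewrite /Z -mulr_sumr exchange_big; congr (_ * _); apply: eq_bigr => p _ /=.
  by rewrite -!mulr_sumr sum_eq_natr mulr1.
have S2 w y1 y2 x v2 : \sum_v1 Z w y1 y2 x v1 v2 =
    #|P|%:R^-1 * \sum_p (x == fx w p)%:R * (v2 == f2 w y2 p)%:R.
  rewrite /Z -mulr_sumr exchange_big; congr (_ * _); apply: eq_bigr => p _ /=.
  by rewrite -mulr_sumr -mulr_suml sum_eq_natr mul1r.
(* With [x] summed out, exactly one pad leads to [v2], so neither [w] nor [y2] remains. *)
have S1 w y1 y2 v1 v2 : \sum_x Z w y1 y2 x v1 v2 = #|P|%:R^-1 * (v1 == f1 y1)%:R.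
  rewrite /Z -mulr_sumr exchange_big; congr (_ * _).
  rewrite -[RHS]mulr1 -[X in _ = _ * X](f2P w y2 v2) mulr_sumr; apply: eq_bigr => p _ /=.
  by rewrite -mulr_suml sum_eq_natr mul1r.
have S23 w y1 y2 x : \sum_v1 \sum_v2 Z w y1 y2 x v1 v2 =
    #|P|%:R^-1 * \sum_p (x == fx w p)%:R.
  under eq_bigr do rewrite S3; rewrite -mulr_sumr exchange_big; congr (_ * _).
  by apply: eq_bigr => p _ /=; rewrite -mulr_sumr sum_eq_natr mulr1.
have S13 w y1 y2 v1 : \sum_x \sum_v2 Z w y1 y2 x v1 v2 =
    #|P|%:R^-1 * \sum_(p : P) (v1 == f1 y1)%:R.
  under eq_bigr do rewrite S3; rewrite -mulr_sumr exchange_big; congr (_ * _).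
  by apply: eq_bigr => p _ /=; rewrite -mulr_suml sum_eq_natr mul1r.
have S12 w y1 y2 v2 : \sum_x \sum_v1 Z w y1 y2 x v1 v2 = #|P|%:R^-1.
  rewrite exchange_big /=; under eq_bigr do rewrite S1.
  by rewrite -mulr_sumr sum_eq_natr mulr1.
split=> [w y1 y2 x v1 v2|].
  by rewrite mulr_ge0 ?invr_ge0 ?ler0n //; apply: sumr_ge0 => p _; rewrite !mulr_ge0 ?ler0n.
split=> [w y1 y2|].
  under eq_bigr do rewrite S23.
  rewrite -mulr_sumr exchange_big /=; under eq_bigr do rewrite sum_eq_natr.
  by rewrite sumr_const mulVf // pnatr_eq0 -lt0n.
do ! split => *; by rewrite ?S3 ?S2 ?S1 ?S23 ?S13 ?S12.
Qed.

Variable F : finFieldType.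
Let q : R := #|F|%:R.
Let W n := #|{: n.-tuple F}|.

Definition pad_word n (w : 'I_(W n) * 'I_(W n)) (p : n.-tuple F) : n.-tuple (F * F) :=
  [tuple (tnth (enum_val w.1) i, tnth p i) | i < n].

(** If [y2] lies on the lines of intercept [p], the correction cancels and [w.2] comes out; as a
    function of [p] it is a bijection, which hides [w]. *)
Definition unpad n (w : 'I_(W n) * 'I_(W n)) (y2 : n.-tuple (F * F)) (p : n.-tuple F) : 'I_(W n) :=
  enum_rank [tuple tnth (enum_val w.2) i +
    ((tnth y2 i).1 + tnth (enum_val w.1) i * (tnth y2 i).2) - tnth p i | i < n].

Lemma sum_unpad n w y2 v : \sum_(p : n.-tuple F) (v == unpad w y2 p)%:R = 1 :> R.
Proof.
pose h i := tnth (enum_val w.2) i +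
  ((tnth y2 i).1 + tnth (enum_val w.1) i * (tnth y2 i).2).
rewrite -[RHS](sum_eq_natr R [tuple h i - tnth (enum_val v) i | i < n]).
apply: eq_bigr => p _; congr (_%:R); congr nat_of_bool; apply/eqP/eqP => [->|->].
  by apply: eq_from_tnth => i; rewrite tnth_mktuple /unpad enum_rankK tnth_mktuple subKr.
rewrite /unpad -[LHS]enum_valK; congr enum_rank; apply: eq_from_tnth => i.
by rewrite !tnth_mktuple subKr.
Qed.

Definition line_box n (w : 'I_(W n) * 'I_(W n)) (y1 : n.-tuple F) (y2 x : n.-tuple (F * F))
    (v1 v2 : 'I_(W n)) : R :=
  #|{: n.-tuple F}|%:R^-1 * \sum_(p : n.-tuple F)
    (x == pad_word w p)%:R * ((v1 == enum_rank y1)%:R * (v2 == unpad w y2 p)%:R).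

Lemma card_words_gt0 n : (0 < W n)%N.
Proof. by apply/card_gt0P; exists (nseq_tuple n 0). Qed.

Lemma line_box_ns n : ns_box (@line_box n).
Proof. exact: (pad_ns_box _ _ (card_words_gt0 n) (@sum_unpad n)). Qed.

(** A nonzero term forces [x = pad_word w p], [y1] equal to the first message, and [y2] on the lines
    of intercept [p]; both outputs are then right. *)
Lemma line_box_correct n w y1 y2 x v1 v2 : (v1 != w.1) || (v2 != w.2) ->
  @line_box n w y1 y2 x v1 v2 * chan_n (@line_ch R F) x y1 y2 = 0.
Proof.
move=> ne; rewrite line_chan_n /line_box -mulrA mulr_suml big1 ?mulr0 // => p _.
have [->|/negbTE] := eqVneq x (pad_word w p); last by rewrite !mul0r.
have [->|/negbTE] := eqVneq y1 (map_tuple fst (pad_word w p)); last by rewrite mul0r mulr0.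
have -> : map_tuple fst (pad_word w p) = enum_val w.1.
  by apply: eq_from_tnth => i; rewrite tnth_map tnth_mktuple.
rewrite enum_valK; case/orP: ne => [/negbTE->|ne]; first by rewrite mul0r mulr0 mul0r.
have [H|] := pselect (forall i, (tnth y2 i).1 + tnth (enum_val w.1) i * (tnth y2 i).2 = tnth p i).
  have -> : unpad w y2 p = w.2.
    rewrite /unpad -[RHS]enum_valK; congr enum_rank; apply: eq_from_tnth => i.
    by rewrite tnth_mktuple H addrK.
  by rewrite (negbTE ne) !mulr0 mul0r.
move=> /existsNP[i /eqP/negbTE ni].
by rewrite /line_out (bigD1 i) //= !tnth_mktuple /= ni !mul0r !mulr0.
Qed.

Lemma line_ns_achievable : ns_achievable (@line_ch R F) (log2 q, log2 q).
Proof.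
exists W, W, line_box; split=> [n|]; first by rewrite card_words_gt0.
split=> [n|]; first exact: line_box_ns.
split.
  have E n : nserr1 (@line_ch R F) (@line_box n) = 0.
    rewrite /nserr1 big1 ?mulr0 // => w _; do 3! (apply: big1 => ? _).
    by apply: big1 => v1 ne; apply: big1 => v2 _; rewrite line_box_correct ?ne.
  have E' n : nserr2 (@line_ch R F) (@line_box n) = 0.
    rewrite /nserr2 big1 ?mulr0 // => w _; do 4! (apply: big1 => ? _).
    by apply: big1 => v2 ne; rewrite line_box_correct // ne orbT.
  under eq_fun do rewrite E E' maxxx.
  exact: cvg_cst.
suff H : (fun n => log2 (W n)%:R / n%:R : R) @ \oo --> log2 q by exists (log2 q), (log2 q).
apply: cvg_near_cst; near=> n.
have n0 : (0 < n)%N by near: n; exists 1%N.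
rewrite /W card_tuple natrX log2X; last by rewrite (lt_trans ltr01) // card_gt1.
by rewrite mulrAC divff ?mul1r // pnatr_eq0 -lt0n.
Unshelve. all: by end_near. Qed.

Lemma line_ratio : 0 < sum_cap (@line_ch R F) /\
  2 * log2 q / log2 (2 * q) <= ns_sum_cap (@line_ch R F) / sum_cap (@line_ch R F).
Proof.
have q1 : 1 < q := card_gt1 R F.
have lq : 0 < log2 q by rewrite divr_gt0 ?ln2_gt0 ?ln_gt0.
have ub : ubound [set r.1 + r.2 | r in cap_region (@line_ch R F)] (log2 (2 * q)).
  by move=> _ [r rC <-]; apply: closure_sum_le rC; exact: line_converse.
(* Positivity of the unassisted sum-capacity comes from the assisted code itself, reduced to
   receiver 1: it is at least [log q]. *)
have [L /= qL LC] := ns_user1_achievable (0 : F) (0 : F * F) (line_bc R F) line_ns_achievable.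
have LS : [set r.1 + r.2 | r in cap_region (@line_ch R F)] L.
  by exists (L, 0); [exact: subset_closure|rewrite /= addr0].
have s0 : 0 < sum_cap (@line_ch R F).
  by apply: (lt_le_trans lq); apply: (le_trans qL); apply: ub_le_sup => //; exists (log2 (2 * q)).
split=> //.
have sle : sum_cap (@line_ch R F) <= log2 (2 * q) by apply: ge_sup => //; exists L.
have nsge : 2 * log2 q <= ns_sum_cap (@line_ch R F).
  apply: ub_le_sup.
    exists (2 * sum_cap (@line_ch R F)); apply: (has_ns_ubound (line_bc R F) (0, 0)).
    by exists (log2 (2 * q)).
  exists (log2 q, log2 q); first by apply: subset_closure; exact: line_ns_achievable.
  by rewrite /= mulr_natl mulr2n.
apply: ler_pM => //; first by rewrite mulr_ge0 // ltW.
  by rewrite invr_ge0 (le_trans _ sle) // ltW.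
by rewrite lef_pV2 // posrE (lt_le_trans s0).
Qed.

End NonSignaling.

(** * The supremum of the ratio *)

Theorem theorem3 (R : realType) :
  ereal_sup [set e : \bar R | exists (X Y1 Y2 : finType) (N : X -> Y1 -> Y2 -> R),
      is_bc N /\ semidet N /\ 0 < sum_cap N /\
      e = (ns_sum_cap N / sum_cap N)%:E] = 2%:E.
Proof.
apply/eqP; rewrite eq_le; apply/andP; split.
  apply: ub_ereal_sup => _ [X [Y1 [Y2 [N [Nbc [_ [s0 ->]]]]]]].
  by rewrite lee_fin ler_pdivrMr // ns_sum_cap_le_twice.
apply/lee_addgt0Pr => e e0.
(* A prime above [2^(2 / e)] has [L = log p >= 2 / e], hence
   [2 L / (1 + L) = 2 - 2 / (1 + L) >= 2 - e]. *)
have [p pb pp] := prime_above (Num.bound (expR (2 / e * ln 2) : R)).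
have [s0 ratio] := line_ratio R 'F_p.
have Ssup : ((ns_sum_cap (@line_ch R 'F_p) / sum_cap (@line_ch R 'F_p))%:E <=
    ereal_sup [set e : \bar R | exists (X Y1 Y2 : finType) (N : X -> Y1 -> Y2 -> R),
      is_bc N /\ semidet N /\ (0 < sum_cap N)%R /\
      e = (ns_sum_cap N / sum_cap N)%:E])%E.
  apply: ereal_sup_ubound.
  exists ('F_p * 'F_p)%type, 'F_p, ('F_p * 'F_p)%type, (@line_ch R 'F_p).
  by split; [exact: line_bc|split; [exact: line_semidet|split]].
apply: le_trans (leeD2r e%:E Ssup); rewrite -EFinD lee_fin.
apply: le_trans (lerD ratio (lexx e)); rewrite -lerBlDr.
rewrite (card_Fp pp).
have p0 : 0 < p%:R :> R by rewrite ltr0n prime_gt0.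
rewrite log2M // log2_2.
have Lp : 2 / e <= log2 p%:R :> R.
  rewrite ler_pdivlMr ?ln2_gt0 // -ler_expR lnK ?posrE //.
  apply: ltW; apply: (@lt_trans _ _ (Num.bound (expR (2 / e * ln 2) : R))%:R).
    by apply: archi_boundP; exact: expR_ge0.
  by rewrite ltr_nat.
have L0 : 0 < log2 p%:R :> R by apply: lt_le_trans Lp; rewrite divr_gt0.
move: Lp; rewrite ler_pdivrMr // => Lp.
by rewrite ler_pdivlMr; [move: Lp; lra|rewrite addr_gt0].
Qed.
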